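(* Let $N\geq1$, $p\geq1$, and let $f:\mathbb{R}^N\times\mathbb{M}^{N\times N}\to[0,+\infty]$ be a normal integrand satisfying: there exist $\alpha,\beta>0$ such that for every $(x,\xi)\in\mathbb{R}^N\times\mathbb{M}^{N\times N}$, if $|\det\xi|\geq\alpha$ then $f(x,\xi)\leq\beta(1+|\xi|^p)$. Then $\mathcal{Z} f$ is of $p$-polynomial growth, i.e. there is $c>0$ with $\mathcal{Z} f(x,\xi)\leq c(1+|\xi|^p)$ for all $(x,\xi)\in\mathbb{R}^N\times\mathbb{M}^{N\times N}$.
   Context: $\mathbb{M}^{N\times N}$: real $N\times N$ matrices. A normal integrand is a measurable $f$ with $f(x,\cdot)$ lower semicontinuous for each $x$. With $Y:=]0,1[^N$, $\mathcal{Z} f(x,\xi):=\inf\{\int_Y f(x,\xi+\nabla\varphi(y))dy:\varphi\in W^{1,\infty}_0(Y;\mathbb{R}^N)\}$, where $W^{1,\infty}_0(Y;\mathbb{R}^N)$ is the set of Lipschitz maps vanishing on $\partial Y$. *)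

(* Defs.v *)
From HB Require Import structures.
From mathcomp Require Import all_boot all_order all_algebra.
From mathcomp Require Import all_classical all_reals all_analysis.
From mathcomp Require Import measurable_realfun.

Set Implicit Arguments.
Unset Strict Implicit.
Unset Printing Implicit Defensive.
Import Order.TTheory GRing.Theory Num.Theory.
Import numFieldNormedType.Exports.

Local Open Scope classical_set_scope.
Local Open Scope ring_scope.

Section Defs.
Context {R : realType}.

Definition frob {N : nat} (xi : 'M[R]_N) : R :=
  Num.sqrt (\sum_(i < N) \sum_(j < N) xi i j ^+ 2).

Definition borel_measurable {T : topologicalType} (g : T -> \bar R) : Prop :=
  forall B : set (\bar R), measurable B -> <<s open >> (g @^-1` B).

Definition normal_integrand {N : nat} (f : 'rV[R]_N * 'M[R]_N -> \bar R) : Prop :=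
  borel_measurable f /\
  forall x : 'rV[R]_N, lower_semicontinuous (fun xi : 'M[R]_N => f (x, xi)).

Definition cube_cl {N : nat} : set 'rV[R]_N :=
  [set y | forall i, 0 <= y ord0 i <= 1].
Definition cube_bd {N : nat} : set 'rV[R]_N :=
  [set y | cube_cl y /\ exists i, y ord0 i = 0 \/ y ord0 i = 1].

(* W^{1,oo}_0(Y;R^N): Lipschitz maps (on the closure of Y) vanishing on dY. *)
Definition W1inf0 {N : nat} : set ('rV[R]_N -> 'rV[R]_N) :=
  [set phi | (exists L : R, forall y z, cube_cl y -> cube_cl z ->
                 `|phi y - phi z| <= L * `|y - z|) /\
             (forall y, cube_bd y -> phi y = 0)].

(* Gradient of phi : R^N -> R^N, (grad phi y) i j = d phi_i / d y_j.
   ('J is the library's Jacobian in row-vector convention, hence the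
   transpose.)  For Lipschitz phi it is the a.e. (Rademacher) derivative,
   which coincides a.e. with the weak gradient. *)
Definition grad {N : nat} (phi : 'rV[R]_N -> 'rV[R]_N) (y : 'rV[R]_N) : 'M[R]_N :=
  ('J phi y)^T.

(* Lebesgue integral over Y = ]0,1[^N, written as the iterated integral
   over the coordinates (Tonelli), using the 1-D Lebesgue measure. *)
Fixpoint cube_integral (n : nat) : ('rV[R]_n -> \bar R) -> \bar R :=
  match n return ('rV[R]_n -> \bar R) -> \bar R with
  | 0 => fun g => g 0
  | n'.+1 => fun g =>
      (\int[@lebesgue_measure R]_(t in `]0%R, 1%R[%classic)
         cube_integral (fun v : 'rV[R]_n' => g (row_mx (const_mx t : 'rV[R]_1) v)))%E
  end.

Definition Zf {N : nat} (f : 'rV[R]_N * 'M[R]_N -> \bar R)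
    (x : 'rV[R]_N) (xi : 'M[R]_N) : \bar R :=
  ereal_inf [set cube_integral (fun y => f (x, xi + grad phi y)) | phi in W1inf0].

End Defs.

(* Main.v *)
(* Everything reduces to one Lipschitz field vanishing on the boundary of the
   cube whose gradient is close to a diagonal matrix of signs almost
   everywhere: a multiple m of it, with m of order 1 + |xi|, makes
   xi + grad phi diagonally dominant, hence of determinant at least
   (m / 2) ^ N, while its norm stays of order 1 + |xi|.

   The k-th component of the field is the infimum over n of
     dist (y_k, 4^-n Z) + eps (1 - 2^-n) dist (y, boundary).
   The first term has slope +-1 along y_k and the second is eps-Lipschitz.
   The penalty selects ever finer folds near the boundary, which forces the
   value 0 there, while only finitely many n matter near an interior point.
   Where 1, y_1, ..., y_N are linearly independent over the rationals, a
   finite minimum of affine functions with rational coefficients is locally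
   one of them; such points are conull for the iterated integral because
   their complement is a countable union of hyperplanes. *)

Require Import Defs.
From HB Require Import structures.
From mathcomp Require Import all_boot all_order all_algebra.
From mathcomp Require Import all_classical all_reals all_analysis.
From mathcomp Require Import measurable_realfun.
From mathcomp Require Import ring lra.

Set Implicit Arguments.
Unset Strict Implicit.
Unset Printing Implicit Defensive.

Import Order.TTheory GRing.Theory Num.Theory.
Import numFieldNormedType.Exports.
Local Open Scope classical_set_scope.
Local Open Scope ring_scope.

(** * Determinants of diagonally dominant matrices *)

(** One step of block elimination: [A] is a unit lower triangular block matrix times an upper
    triangular one whose corner is the Schur complement. *)
Lemma det_schur (F : fieldType) (n : nat) (A : 'M[F]_(1 + n)) :
  A 0 0 != 0 ->
  \det A = A 0 0 * \det (drsubmx A - (A 0 0)^-1 *: (dlsubmx A *m ursubmx A)).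
Proof.
move=> a0; set a := A 0 0; set S := drsubmx A - _.
have -> : A = block_mx 1%:M 0 (a^-1 *: dlsubmx A) 1%:M *m
              block_mx a%:M (ursubmx A) 0 S.
  rewrite mulmx_block !mul1mx !mul0mx !addr0 mul_mx_scalar scalerA.
  rewrite divff // scale1r -scalemxAl addrC subrK -[LHS]submxK.
  congr block_mx; apply/matrixP => i j.
  by rewrite !ord1 !mxE eqxx mulr1n /a; congr (A _ _); apply: val_inj.
by rewrite det_mulmx det_lblock !det1 !mul1r det_ublock det_scalar1.
Qed.

(** Induction through the Schur complement: the pivot contributes a factor at least [m], and the
    complement is dominant with the same margin [m]. *)
Lemma diag_dominant_det_ge (F : realFieldType) (n : nat) (A : 'M[F]_n) (m : F) :
  0 < m -> (forall i, m + \sum_(j < n | j != i) `|A i j| <= `|A i i|) ->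
  m ^+ n <= `|\det A|.
Proof.
move=> m0; elim: n A => [|n IHn] A; first by rewrite det_mx00 normr1.
move: A; rewrite -[n.+1]/(1 + n)%N => A dom.
have sum0 : \sum_(j < 1 + n | j != 0) `|A 0 j| = \sum_(j < n) `|ursubmx A 0 j|.
  rewrite big_mkcond big_ord_recl eqxx /= add0r; apply: eq_bigr => j _.
  by rewrite !mxE; congr `|A _ _|; apply: val_inj.
have sumS i : \sum_(j < 1 + n | j != lift 0 i) `|A (lift 0 i) j| =
    `|dlsubmx A i 0| + \sum_(j < n | j != i) `|drsubmx A i j|.
  rewrite big_mkcond big_ord_recl; congr (_ + _).
    by rewrite !mxE; congr `|A _ _|; apply: val_inj.
  rewrite [RHS]big_mkcond; apply: eq_bigr => j _.
  rewrite (inj_eq lift_inj); case: ifP => // _.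
  by rewrite !mxE; congr `|A _ _|; apply: val_inj.
have := dom 0; rewrite sum0 => dom0.
have sb0 : 0 <= \sum_(j < n) `|ursubmx A 0 j| by apply: sumr_ge0.
have a_gt0 : 0 < `|A 0 0| by lra.
have a_neq0 : A 0 0 != 0 by rewrite -normr_gt0.
rewrite det_schur // normrM exprS; apply: ler_pM => //; first exact: ltW.
- by apply: exprn_ge0; exact: ltW.
- by lra.
apply: IHn => i; set S := _ - _.
pose c := `|dlsubmx A i 0|; pose b j := `|ursubmx A 0 j| / `|A 0 0|.
have SE j :
    S i j = drsubmx A i j - (A 0 0)^-1 * (dlsubmx A i 0 * ursubmx A 0 j).
  rewrite /S [LHS]mxE; congr (_ + _); rewrite [LHS]mxE; congr (- _).
  by rewrite [LHS]mxE; congr (_ * _); rewrite [LHS]mxE big_ord1.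
have cbE j : `|(A 0 0)^-1 * (dlsubmx A i 0 * ursubmx A 0 j)| = c * b j.
  by rewrite !normrM normfV /c /b; ring.
have offd : \sum_(j < n | j != i) `|S i j| <=
    \sum_(j < n | j != i) `|drsubmx A i j| + c * \sum_(j < n | j != i) b j.
  rewrite mulr_sumr -big_split; apply: ler_sum => j _.
  by rewrite SE -cbE; exact: ler_normB.
have diag : `|drsubmx A i i| - c * b i <= `|S i i|.
  by rewrite SE -cbE; exact: lerB_dist.
(* Dominance of row 0. Elimination thus perturbs row [i] by at most [c] in total, which is exactly
   the weight of the entry removed from that row. *)
have b1 : b i + \sum_(j < n | j != i) b j <= 1.
  rewrite -[leLHS](bigD1 i (P := predT)) //= -mulr_suml ler_pdivrMr // mul1r.
  by apply: le_trans dom0; rewrite lerDr ltW.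
have domi := dom (lift 0 i); rewrite sumS in domi.
have Dii : A (lift 0 i) (lift 0 i) = drsubmx A i i.
  by rewrite !mxE; congr (A _ _); apply: val_inj.
rewrite Dii -/c in domi.
have : c * (b i + \sum_(j < n | j != i) b j) <= c.
  by rewrite -[leRHS]mulr1 ler_wpM2l // /c.
rewrite mulrDr; lra.
Qed.

(** * Bounding the iterated integral off a null set *)

Import HBNNSimple.

(* No measurability is required of [g]: the library integral of a nonnegative
   function is a supremum over the simple functions below it. *)
Lemma ge0_integral_le_cst_ae d (T : measurableType d) (R : realType)
    (mu : {measure set T -> \bar R}) (D Z : set T) (g : T -> \bar R) (c : R) :
  measurable D -> measurable Z -> mu Z = 0%E -> 0 <= c ->
  (forall t, D t -> (0 <= g t)%E) ->
  (forall t, D t -> ~ Z t -> (g t <= c%:E)%E) ->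
  (\int[mu]_(t in D) g t <= c%:E * mu D)%E.
Proof.
move=> mD mZ Z0 c0 g0 gc; rewrite ge0_integralE //.
(* Each simple function [h] below [g] is measurable, so [h] can be compared almost everywhere with
   the constant. *)
apply: ge_ereal_sup => _ [h /= hg <-].
rewrite -integralT_nnsfun -integral_cst //= [leRHS]integral_mkcond /=.
apply: ae_ge0_le_integral => //.
- by move=> t _; rewrite lee_fin; exact: fun_ge0.
- exact/measurable_EFinP.
- by move=> t _; apply: erestrict_ge0 => *; rewrite lee_fin.
- apply/(measurable_restrictT _ mD); exact: measurable_cst.
exists Z; split=> // t /= /not_implyP [_] tle.
apply: contrapT => nZ; apply: tle; apply: le_trans (hg t) _.
rewrite /patch; case: ifPn => // /[!inE] Dt; exact: gc.
Qed.

Lemma cube_integral_ge0 (R : realType) n (g : 'rV[R]_n -> \bar R) :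
  (forall y, (0 <= g y)%E) -> (0 <= cube_integral g)%E.
Proof.
elim: n g => [|n IHn] g g0 /=; first exact: g0.
by apply: integral_ge0 => t _; apply: IHn.
Qed.

(** Induction on the dimension, slicing along the first coordinate. The guard [a i != 0] lets the
    index type [I] stay fixed although some linear parts vanish on slices. *)
Lemma cube_integral_le_off_hyperplanes (R : realType) n (I : countType)
    (a : I -> 'rV[R]_n) (b : I -> R) (g : 'rV[R]_n -> \bar R) (c : R) :
  0 <= c -> (forall y, (0 <= g y)%E) ->
  (forall y : 'rV[R]_n, (forall i, 0 < y 0 i < 1) ->
     (forall i, a i != 0 -> \sum_j a i 0 j * y 0 j + b i != 0) ->
     (g y <= c%:E)%E) ->
  (cube_integral g <= c%:E)%E.
Proof.
move=> c0; elim: n a b g => [|n IHn] a b g g0 gc /=.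
  by apply: gc => [[]//|i]; rewrite [a i]thinmx0 eqxx.
pose hd i := a i 0 0; pose tl i : 'rV[R]_n := \row_j a i 0 (lift 0 j).
(* At most one exceptional [t] per index, hence a countable set. *)
pose Z := [set t : R | exists2 i, hd i != 0 & hd i * t + b i = 0].
have cZ : countable Z.
  apply: (@sub_countable _ _ _ [set - b i / hd i | i in setT]).
    apply: subset_card_le => t [i hi /eqP]; rewrite addr_eq0 => /eqP e.
    by exists i => //; rewrite -e mulrC mulKf.
  by apply: card_le_trans (card_image_le _ _) _; exact: countableP.
have mZ : measurable Z by exact: countable_measurable.
have Z0 := countable_lebesgue_measure0 cZ.
apply: (@le_trans _ _ (c%:E * @lebesgue_measure R `]0%R, 1%R[%classic)%E);
  last first.
  by rewrite lebesgue_measure_itv /= lte_fin ltr01 sube0 mule1.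
apply: (@ge0_integral_le_cst_ae _ _ _ (@lebesgue_measure R) _ Z) => //.
- by move=> t _; exact: cube_integral_ge0.
- move=> t /= /[!in_itv] /= t01 tZ.
  apply: (IHn tl (fun i => hd i * t + b i)) => // v v01 vH.
  set y := row_mx _ _.
  have y0 : y 0 0 = t.
    rewrite /y (_ : 0 = lshift n 0 :> 'I_(1 + n)) ?row_mxEl ?mxE //.
    exact: val_inj.
  have yS j : y 0 (lift 0 j) = v 0 j.
    rewrite /y (_ : lift 0 j = rshift 1 j :> 'I_(1 + n)) ?row_mxEr //.
    exact: val_inj.
  apply: gc => [i|i ai].
    by have [j ->|->] := unliftP 0 i; rewrite ?y0 ?yS.
  rewrite big_ord_recl y0; under eq_bigr do rewrite yS.
  (* Either the hyperplane cuts the slice in a hyperplane, which [v] avoids, or it is a level set of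
     the first coordinate, which [tZ] excludes. *)
  have [tl0|tln0] := eqVneq (tl i) 0; last first.
    have := vH i tln0; rewrite -/(hd i).
    rewrite (eq_bigr (fun j => a i 0 (lift 0 j) * v 0 j)) => [|j _];
      last by rewrite mxE.
    by rewrite addrA [X in X + b i]addrC.
  have tlE j : a i 0 (lift 0 j) = 0.
    by move/rowP/(_ j): tl0; rewrite !mxE.
  rewrite big1 ?addr0 => [|j _]; last by rewrite tlE mul0r.
  apply/eqP => h; apply: tZ; exists i => //; apply: contra ai => /eqP hd0.
  apply/eqP/rowP => j; rewrite mxE.
  by have [k ->|->] := unliftP 0 j; rewrite ?tlE.
Qed.

(** * Sup norm of matrices and Jacobians of locally affine maps *)

Lemma ler_norm_coord (R : realType) (m n : nat) (A : 'M[R]_(m, n)) i j :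
  `|A i j| <= `|A|.
Proof.
rewrite {2}/Num.norm /= mx_normrE.
exact: (le_bigmax _ (fun k : 'I_m * 'I_n => `|A k.1 k.2|) (i, j)).
Qed.

Lemma ler_mx_norm (R : realType) (m n : nat) (A : 'M[R]_(m, n)) (c : R) :
  0 <= c -> (forall i j, `|A i j| <= c) -> `|A| <= c.
Proof.
move=> c0 Ac; rewrite {1}/Num.norm /= mx_normrE.
by apply: bigmax_le => // -[i j] _; exact: Ac.
Qed.

(** The first-order remainder vanishes identically near [y], so uniqueness of the differential
    applies once [mulmxr A] is known to be continuous. *)
Lemma jacobian_near_affine (R : realType) (n : nat)
    (phi : 'rV[R]_n -> 'rV[R]_n) (y b : 'rV[R]_n) (A : 'M[R]_n) :
  (\forall z \near y, phi z = z *m A + b) -> 'J phi y = A.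
Proof.
move=> phiE.
have phiE0 : \forall h \near (0 : 'rV[R]_n), phi (h + y) = (h + y) *m A + b.
  by move: phiE; rewrite (near_shift 0) subr0.
have dfE : 'd phi y = mulmxr A :> ('rV[R]_n -> 'rV[R]_n).
  apply: diff_unique.
    apply: bounded_linear_continuous; exists (\sum_i \sum_j `|A i j|); split.
      exact: num_real.
    move=> M ltM; near=> v.
    have v1 : `|v| <= 1 by near: v; exact: (@nbhs0_le R 'rV[R]_n 1 ltr01).
    apply: ler_mx_norm => [|i j].
      by apply: le_trans (ltW ltM); do 2![apply: sumr_ge0 => ? _].
    apply: le_trans (ltW ltM); rewrite mxE.
    apply: le_trans (ler_norm_sum _ _ _) _; apply: ler_sum => k _.
    rewrite (bigD1 j) //= -[leLHS]addr0; apply: lerD; last exact: sumr_ge0.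
    by rewrite normrM ler_piMl // (le_trans (ler_norm_coord _ _ _)).
  apply/eqaddoP => e e0; near=> h.
  rewrite !fctE /=.
  have -> : phi (h + y) = (h + y) *m A + b by near: h.
  rewrite (nbhs_singleton phiE) mulmxDl.
  rewrite -[X in X - _]addrA [X in X - _]addrC subrr normr0.
  by rewrite mulr_ge0 // ltW.
rewrite /jacobian; apply/matrixP => i j.
by rewrite mxE dfE /= -rowE mxE.
Unshelve. all: by end_near.
Qed.

(** * Functions that are locally affine with rational coefficients *)

Section RationalAffine.
Context {R : realType} {N : nat}.
Implicit Types (q : 'rV[rat]_N) (b : rat) (y z : 'rV[R]_N).
Implicit Types (f g : 'rV[R]_N -> R) (P Q : set 'rV[rat]_N).

Definition rat_affine q b z : R := \sum_j ratr (q 0 j) * z 0 j + ratr b.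

(** Linear independence of 1, y_1, ..., y_N over the rationals: once [q = 0], the equation forces
    [b = 0] too. *)
Definition rat_generic y := forall q b, rat_affine q b y = 0 -> q = 0.

(** [P] constrains the linear part only, since only gradients have to be tracked. *)
Definition affine_near P f y :=
  exists q b, P q /\ \forall z \near y, f z = rat_affine q b z.

Lemma rat_affineD q1 b1 q2 b2 z :
  rat_affine (q1 + q2) (b1 + b2) z = rat_affine q1 b1 z + rat_affine q2 b2 z.
Proof.
rewrite /rat_affine addrACA -big_split rmorphD; congr (_ + _).
by apply: eq_bigr => j _; rewrite mxE rmorphD mulrDl.
Qed.

Lemma rat_affineZ r q b z :
  rat_affine (r *: q) (r * b) z = ratr r * rat_affine q b z.
Proof.
rewrite /rat_affine mulrDr mulr_sumr rmorphM; congr (_ + _).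
by apply: eq_bigr => j _; rewrite mxE rmorphM mulrA.
Qed.

Lemma rat_affineN q b z : rat_affine (- q) (- b) z = - rat_affine q b z.
Proof. by rewrite -[- q]scaleN1r -[- b]mulN1r rat_affineZ rmorphN1 mulN1r. Qed.

Lemma rat_affine_continuous q b : continuous (rat_affine q b).
Proof.
pose S (s : seq 'I_N) := fun z : 'rV[R]_N => \sum_(j <- s) ratr (q 0 j) * z 0 j.
suff cS s : continuous (S s).
  move=> z; apply: (@continuousD _ _ _ (S (index_enum _)) (cst (ratr b))).
    exact: cS.
  exact: cst_continuous.
elim: s => [|j s IHs].
  have -> : S [::] = cst 0 by apply/funext => z; rewrite /S big_nil.
  exact: cst_continuous.
have -> : S (j :: s) = (fun z => ratr (q 0 j) * z 0 j) + S s.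
  by apply/funext => z; rewrite /S big_cons.
move=> z; apply: continuousD; last exact: IHs.
apply: (@continuousM _ _ (cst (ratr (q 0 j))) (fun z => z 0 j)).
  exact: cst_continuous.
exact: coord_continuous.
Qed.

Lemma affine_near_sub P Q f y : P `<=` Q ->
  affine_near P f y -> affine_near Q f y.
Proof. by move=> PQ [q [b [Pq fE]]]; exists q, b; split=> //; exact: PQ. Qed.

Lemma affine_near_eq P f g y :
  (\forall z \near y, f z = g z) -> affine_near P g y -> affine_near P f y.
Proof.
move=> fg [q [b [Pq gE]]]; exists q, b; split=> //; near=> z.
by transitivity (g z); near: z.
Unshelve. all: by end_near. Qed.

Lemma affine_near_cst y r : affine_near [set 0] (fun=> ratr r) y.
Proof.
exists 0, r; split=> //; near=> z; rewrite /rat_affine big1 ?add0r // => j _.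
by rewrite mxE rmorph0 mul0r.
Unshelve. all: by end_near. Qed.

Lemma affine_near_coord y k : affine_near [set delta_mx 0 k] (fun z => z 0 k) y.
Proof.
exists (delta_mx 0 k), 0; split=> //; near=> z.
rewrite /rat_affine rmorph0 addr0 (bigD1 k) //= mxE !eqxx rmorph1 mul1r.
rewrite big1 ?addr0 // => j jk; by rewrite mxE (negbTE jk) andbF rmorph0 mul0r.
Unshelve. all: by end_near. Qed.

Lemma affine_nearD P Q f g y : affine_near P f y -> affine_near Q g y ->
  affine_near [set p.1 + p.2 | p in P `*` Q] (fun z => f z + g z) y.
Proof.
move=> [p [a [Pp fE]]] [q [b [Qq gE]]]; exists (p + q), (a + b); split.
  by exists (p, q).
near=> z; rewrite rat_affineD; congr (_ + _); by near: z.
Unshelve. all: by end_near. Qed.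

Lemma affine_nearZ P f y r : affine_near P f y ->
  affine_near [set r *: p | p in P] (fun z => ratr r * f z) y.
Proof.
move=> [p [a [Pp fE]]]; exists (r *: p), (r * a); split; first by exists p.
near=> z; rewrite rat_affineZ; congr (_ * _); by near: z.
Unshelve. all: by end_near. Qed.

Lemma affine_near_cstB P f y r : affine_near P f y ->
  affine_near [set - p | p in P] (fun z => ratr r - f z) y.
Proof.
move=> [p [a [Pp fE]]]; exists (- p), (r - a); split; first by exists p.
near=> z; rewrite -[- p]add0r rat_affineD rat_affineN; congr (_ - _);
  last by near: z.
rewrite /rat_affine big1 ?add0r // => j _; by rewrite mxE rmorph0 mul0r.
Unshelve. all: by end_near. Qed.

(* At a generic point two rational affine functions which agree have the same
   linear part, so a tie in the minimum creates no kink. *)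
Lemma affine_near_min P f g y : rat_generic y ->
  affine_near P f y -> affine_near P g y ->
  affine_near P (fun z => Num.min (f z) (g z)) y.
Proof.
move=> gen_y.
wlog lefg : f g / f y <= g y => [hwlog|] fP gP.
  have [/hwlog|/ltW /hwlog] := leP (f y) (g y); first exact.
  move=> /(_ gP fP); apply: affine_near_eq; near=> z; exact: minC.
move: fP gP => [p [a [Pp fE]]] [q [b [Qq gE]]].
have fy := nbhs_singleton fE; have gy := nbhs_singleton gE.
exists p, a; split=> //.
have [ltfg|eqfg] : f y < g y \/ f y = g y.
  by move: lefg; rewrite le_eqVlt => /predU1P[]; [right|left].
- have /cvgr_gt : {for y, continuous (rat_affine (q - p) (b - a))}.
    exact: rat_affine_continuous.
  rewrite rat_affineD rat_affineN -fy -gy => /(_ 0).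
  rewrite subr_gt0 => /(_ ltfg) pos.
  near=> z.
  have <- : f z = rat_affine p a z by near: z.
  apply: min_l; rewrite -subr_ge0.
  have -> : f z = rat_affine p a z by near: z.
  have -> : g z = rat_affine q b z by near: z.
  by rewrite -rat_affineN -rat_affineD ltW //; near: z.
have dE : rat_affine (p - q) (a - b) y = 0.
  by rewrite rat_affineD rat_affineN -fy -gy eqfg subrr.
have pq : p = q by apply/eqP; rewrite -subr_eq0; apply/eqP; exact: gen_y dE.
have ab : a = b.
  move: dE; rewrite pq subrr /rat_affine big1.
    by rewrite add0r => /eqP; rewrite fmorph_eq0 subr_eq0 => /eqP.
  by move=> j _; rewrite mxE rmorph0 mul0r.
near=> z.
have -> : f z = rat_affine p a z by near: z.
have -> : g z = rat_affine q b z by near: z.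
by rewrite -pq -ab minxx.
Unshelve. all: by end_near. Qed.

Lemma affine_near_bigmin P (I : Type) (s : seq I) f (F : I -> 'rV[R]_N -> R) y :
  rat_generic y -> affine_near P f y -> (forall i, affine_near P (F i) y) ->
  affine_near P (fun z => \big[Num.min/f z]_(i <- s) F i z) y.
Proof.
move=> gen_y fP FP; elim: s => [|i s IHs].
  by under eq_fun do rewrite big_nil.
under eq_fun do rewrite big_cons.
exact: affine_near_min.
Qed.

End RationalAffine.

(** * Sawtooth functions obtained by repeated folding *)

Lemma dist_min_le (R : realDomainType) (a b c d e : R) :
  `|a - c| <= e -> `|b - d| <= e -> `|Num.min a b - Num.min c d| <= e.
Proof.
rewrite !ler_norml => /andP[? ?] /andP[? ?].
by apply/andP; split; case: (leP a b) => ?; case: (leP c d) => ?; lra.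
Qed.

Section Folding.
Context {R : realType}.
Implicit Types t s : R.

(* On [0, 1], the distance from [t] to the multiples of [2 ^- j]. *)
Fixpoint fold (j : nat) t : R :=
  if j is i.+1 then Num.min (fold i t) (2^-1 ^+ j - fold i t)
  else Num.min t (1 - t).

(** Reflecting a function with values in [[0, h]] about height [h / 2] halves its range. *)
Lemma fold_bounds j t : 0 <= t <= 1 -> 0 <= fold j t <= 2^-1 ^+ j.+1.
Proof.
move=> /andP[t0 t1]; elim: j => [|j /andP[IH0 IH1]].
  by rewrite expr1 /=; case: (leP t (1 - t)) => ?; lra.
rewrite [2^-1 ^+ j.+2]exprS [fold _ _]/=.
by case: (leP (fold j t) (2^-1 ^+ j.+1 - fold j t)) => ?; lra.
Qed.

Lemma fold_lipschitz j t s : `|fold j t - fold j s| <= `|t - s|.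
Proof.
elim: j => [|j IHj] /=; apply: dist_min_le => //.
  by rewrite (_ : _ - _ = - (t - s)) ?normrN //; ring.
by rewrite (_ : _ - _ = - (fold j t - fold j s)) ?normrN //; ring.
Qed.

End Folding.

Lemma half_expn_lt (R : realType) (e : R) : 0 < e -> exists n, 2^-1 ^+ n < e.
Proof.
move=> e0; exists (Num.Def.archi_bound e^-1).
by rewrite exprVn invf_plt ?posrE ?exprn_gt0 //; exact: upper_nthrootP.
Qed.

(** * The scalar components: infima of penalized folds *)

Section Bump.
Context {R : realType} {N : nat}.
Implicit Types (y z : 'rV[R]_N) (k : 'I_N) (eps : rat).

(** On the cube, the sup-norm distance to the boundary; it is negative outside. Each term is at most
    1/2, so the default 1 is never attained when [N] is positive. *)
Definition depth y : R := \big[Num.min/1]_i Num.min (y 0 i) (1 - y 0 i).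

Lemma depth_le y i : depth y <= Num.min (y 0 i) (1 - y 0 i).
Proof. exact: (bigmin_le _ i (fun i => Num.min (y 0 i) (1 - y 0 i))). Qed.

Lemma depth_ge0 y : cube_cl y -> 0 <= depth y.
Proof.
move=> yc; apply: le_bigmin => // i _.
by have /andP[y0 y1] := yc i; rewrite le_min y0 subr_ge0.
Qed.

Lemma depth_gt0 y : (forall i, 0 < y 0 i < 1) -> 0 < depth y.
Proof.
move=> yc; apply: lt_bigmin => // i _.
by have /andP[y0 y1] := yc i; rewrite lt_min y0 subr_gt0.
Qed.

Lemma depth_ge0_cube_cl y : 0 <= depth y -> cube_cl y.
Proof.
move=> d0 i; have := le_trans d0 (depth_le y i).
by rewrite le_min subr_ge0.
Qed.

Lemma depth_bd y : cube_bd y -> depth y = 0.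
Proof.
move=> [yc [i yi]]; apply/eqP; rewrite eq_le depth_ge0 // andbT.
apply: le_trans (depth_le y i) _; rewrite ge_min subr_le0.
by case: yi => ->; rewrite lexx ?orbT.
Qed.

Lemma depth_lipschitz y z : `|depth y - depth z| <= `|y - z|.
Proof.
have crd i : `|y 0 i - z 0 i| <= `|y - z|.
  by have := ler_norm_coord (y - z) 0 i; rewrite !mxE.
apply: (big_ind2 (fun a b => `|a - b| <= `|y - z|)) => [|a b c d|i _].
- by rewrite subrr normr0.
- exact: dist_min_le.
- apply: dist_min_le => //.
  by rewrite (_ : _ - _ = - (y 0 i - z 0 i)) ?normrN //; ring.
Qed.

(** The doubling in [n.*2] makes the fold height of order 4^-n, so that near an interior point it is
    eventually beaten by penalty increments of order 2^-n. Rational weights keep the layers within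
    [affine_near]. *)
Definition layer eps k (n : nat) y : R :=
  fold n.*2 (y 0 k) + ratr (eps * (1 - 2^-1 ^+ n)) * depth y.

Definition bump eps k y : R := inf (range (layer eps k ^~ y)).

Lemma coef_bounds eps n : 0 <= eps -> 0 <= eps * (1 - 2^-1 ^+ n) <= eps.
Proof.
move=> e0; have h0 : (0 : rat) <= 2^-1 ^+ n by exact: exprn_ge0.
have h1 : (2^-1 ^+ n : rat) <= 1 by exact: exprn_ile1.
by rewrite mulr_ge0 ?subr_ge0 //= ler_piMr // gerBl.
Qed.

Lemma layer_ge0 eps k n y : 0 <= eps -> cube_cl y -> 0 <= layer eps k n y.
Proof.
move=> e0 yc; have /andP[f0 _] := fold_bounds n.*2 (yc k).
have /andP[c0 _] := coef_bounds n e0.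
by rewrite addr_ge0 // mulr_ge0 ?depth_ge0 // ler0q.
Qed.

Lemma bump_lbound eps k y : 0 <= eps -> cube_cl y ->
  has_lbound (range (layer eps k ^~ y)).
Proof. by move=> e0 yc; exists 0 => _ [n _ <-]; exact: layer_ge0. Qed.

(** The fold contributes 1 to the constant and the penalty at most [eps]. *)
Lemma layer_lipschitz eps k n y z : 0 <= eps <= 1 ->
  `|layer eps k n y - layer eps k n z| <= 2 * `|y - z|.
Proof.
move=> /andP[e0 e1]; have /andP[c0 c1] := coef_bounds n e0.
have fl := le_trans (fold_lipschitz n.*2 (y 0 k) (z 0 k)) _.
have := ler_norm_coord (y - z) 0 k; rewrite !mxE => /fl {}fl.
rewrite /layer opprD addrACA -mulrBr (le_trans (ler_normD _ _)) //.
rewrite mulrDl mul1r lerD // normrM ger0_norm ?ler0q //.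
rewrite -[leRHS]mul1r ler_pM ?ler0q // ?depth_lipschitz //.
by rewrite -(rmorph1 (ratr : rat -> R)) ler_rat (le_trans c1).
Qed.

(** An infimum of functions with a common Lipschitz constant keeps that constant. *)
Lemma bump_lipschitz eps k y z : 0 <= eps <= 1 -> cube_cl y -> cube_cl z ->
  `|bump eps k y - bump eps k z| <= 2 * `|y - z|.
Proof.
move=> e01; have /andP[e0 _] := e01.
have half u v : cube_cl u -> cube_cl v ->
    bump eps k u - 2 * `|u - v| <= bump eps k v.
  move=> uc vc; apply: lb_le_inf; first by exists (layer eps k 0 v), 0%N.
  move=> _ [n _ <-].
  have : bump eps k u <= layer eps k n u.
    by apply: ge_inf; [exact: bump_lbound|exists n].
  have := layer_lipschitz k n u v e01; rewrite ler_norml => /andP[_]; lra.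
move=> yc zc; rewrite ler_norml; apply/andP; split.
  by have := half _ _ zc yc; rewrite distrC; lra.
by have := half _ _ yc zc; lra.
Qed.

(** On the boundary the penalty vanishes, and the heights of the remaining folds tend to 0. *)
Lemma bump_bd eps k y : 0 <= eps -> cube_bd y -> bump eps k y = 0.
Proof.
move=> e0 ybd; have yc := ybd.1; apply/eqP; rewrite eq_le; apply/andP; split.
  apply/ler_addgt0Pr => e e_gt0; rewrite add0r.
  have [n ltne] := half_expn_lt e_gt0.
  have /andP[_ fn] := fold_bounds n.*2 (yc k).
  apply: (@le_trans _ _ (layer eps k n y)).
    by apply: ge_inf; [exact: bump_lbound|exists n].
  rewrite /layer depth_bd // mulr0 addr0 (le_trans fn) //.
  apply: le_trans (ltW ltne); apply: ler_wiXn2l; [lra|lra|].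
  by rewrite -addnn -addnS leq_addr.
apply: lb_le_inf; first by exists (layer eps k 0 y), 0%N.
by move=> _ [n _ <-]; exact: layer_ge0.
Qed.

(* From layer [m] on, the penalty on [depth] outweighs what finer folds gain. *)
Lemma bump_bigmin eps k m y : 0 < eps -> cube_cl y ->
  2^-1 ^+ m <= ratr eps * depth y ->
  bump eps k y = \big[Num.min/layer eps k 0 y]_(n < m.+1) layer eps k n y.
Proof.
move=> e0 yc hm; apply/eqP; rewrite eq_le; apply/andP; split.
  have lb := bump_lbound k (ltW e0) yc.
  by apply: le_bigmin => [|i _]; apply: ge_inf => //; eexists.
apply: lb_le_inf; first by exists (layer eps k 0 y), 0%N.
move=> _ [n _ <-]; have [lenm|ltmn] := ltnP n m.+1.
  exact: (bigmin_le _ (Ordinal lenm) (fun n : 'I_m.+1 => layer eps k n y)).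
(* Layer [m] lies below layer [n] for [n > m]: with [h], [l], [s] as set below, [l <= h / 2] and
   [h <= s], so the extra penalty [s * (h - l)] is at least [h * h / 2], a bound for the fold of
   layer [m]. *)
apply: le_trans (bigmin_le _ ord_max _) _.
have /andP[_ fm] := fold_bounds m.*2 (yc k).
have /andP[fn _] := fold_bounds n.*2 (yc k).
rewrite /layer /= !rmorphM !rmorphB !rmorph1 !rmorphXn !fmorphV !rmorph_nat.
have : 2^-1 ^+ m.*2.+1 = 2^-1 * (2^-1 ^+ m * 2^-1 ^+ m) :> R.
  by rewrite exprS -addnn exprD.
have hn : 2^-1 ^+ n <= 2^-1 * 2^-1 ^+ m :> R.
  rewrite -exprS; apply: ler_wiXn2l => //; lra.
have m0 : 0 < 2^-1 ^+ m :> R by apply: exprn_gt0.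
move: fm fn hm hn m0.
set s := ratr eps * depth y; set h := 2^-1 ^+ m; set l := 2^-1 ^+ n.
move=> fm fn hm hn m0 E; rewrite E in fm.
rewrite -!mulrA [(1 - h) * _]mulrC [(1 - l) * _]mulrC !mulrA -/s.
have : h * h <= s * h by rewrite ler_wpM2r // ltW.
have : s * l <= s * (2^-1 * h) by rewrite ler_wpM2l //; lra.
lra.
Qed.

Definition bump_grads eps k : set 'rV[rat]_N :=
  [set q | exists2 s : rat, `|s| = 1 &
    forall j, `|q 0 j - s * (j == k)%:R| <= eps].

(** Each reflection only flips the sign of the slope, and minima are harmless at generic points. *)
Lemma affine_near_fold k j y : rat_generic y ->
  affine_near [set delta_mx 0 k; - delta_mx 0 k] (fun z => fold j (z 0 k)) y.
Proof.
move=> gen_y; elim: j => [|j IHj] /=; apply: affine_near_min => //.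
- by apply: affine_near_sub (affine_near_coord y k) => _ ->; left.
- have := affine_near_cstB 1 (affine_near_coord y k); rewrite rmorph1.
  by apply: affine_near_sub => _ [_ -> <-]; right.
- have := affine_near_cstB (2^-1 ^+ j.+1) IHj.
  rewrite rmorphXn /= fmorphV rmorph_nat.
  by apply: affine_near_sub => _ [_ [->|->] <-]; rewrite ?opprK; [right|left].
Qed.

Lemma affine_near_depth y : rat_generic y ->
  affine_near [set q | forall j, `|q 0 j| <= 1] depth y.
Proof.
move=> gen_y.
apply: (@affine_near_bigmin _ _ _ _ _ (cst 1)
  (fun i z => Num.min (z 0 i) (1 - z 0 i))) => // [|i].
  have := affine_near_cst y 1; rewrite rmorph1.
  by apply: affine_near_sub => _ -> j; rewrite mxE normr0.
(* Each term of the minimum defining [depth] is a fold of level 0. *)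
apply: affine_near_sub (affine_near_fold i 0 gen_y) => _ [->|->] j;
  by rewrite !mxE ?normrN; case: (_ && _); rewrite ?normr1 ?normr0.
Qed.

Lemma affine_near_layer eps k n y : 0 <= eps -> rat_generic y ->
  affine_near (bump_grads eps k) (layer eps k n) y.
Proof.
move=> e0 gen_y.
have := affine_nearD (affine_near_fold k n.*2 gen_y)
  (affine_nearZ (eps * (1 - 2^-1 ^+ n)) (affine_near_depth gen_y)).
apply: affine_near_sub => _ [[p q] [/= pk [d d1 <-] <-]].
have /andP[c0 c1] := coef_bounds n e0.
have small j : `|(eps * (1 - 2^-1 ^+ n)) * d 0 j| <= eps.
  by rewrite normrM ger0_norm // (le_trans _ c1) // ler_piMr.
case: pk => ->; [exists 1|exists (-1)]; rewrite ?normrN ?normr1 // => j.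
  by rewrite !mxE eqxx /= mul1r addrC addrK.
by rewrite !mxE eqxx /= mulN1r opprK addrAC addNr add0r.
Qed.

(** As [depth] is 1-Lipschitz, it stays above [depth y / 2] on the ball of that radius, so one
    cutoff [m] serves all nearby points and the infimum is locally a finite minimum. *)
Lemma affine_near_bump eps k y : 0 < eps -> (forall i, 0 < y 0 i < 1) ->
  rat_generic y -> affine_near (bump_grads eps k) (bump eps k) y.
Proof.
move=> e0 yo gen_y; have d0 := depth_gt0 yo.
have [|m hm] := @half_expn_lt R (ratr eps * (depth y / 2)).
  by apply: mulr_gt0; [rewrite ltr0q|exact: divr_gt0].
pose F (n : 'I_m.+1) := layer eps k n.
apply: (@affine_near_eq _ _ _ _
  (fun z => \big[Num.min/layer eps k 0 z]_(n < m.+1) F n z)).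
  near=> z.
  have yz : `|y - z| < depth y / 2.
    by near: z; apply: cvgr_dist_lt; [exact: cvg_id|rewrite divr_gt0].
  have dz : depth y / 2 <= depth z.
    have := le_lt_trans (depth_lipschitz y z) yz.
    by rewrite ltr_norml => /andP[_]; lra.
  apply: bump_bigmin => //; first by apply: depth_ge0_cube_cl; lra.
  by rewrite (le_trans (ltW hm)) // ler_wpM2l // ler0q ltW.
apply: affine_near_bigmin => // [|n]; exact: affine_near_layer (ltW e0) gen_y.
Unshelve. all: by end_near. Qed.

End Bump.

(** * Frobenius norm, determinant and power estimates *)

Lemma coord_le_frob (R : realType) (n : nat) (X : 'M[R]_n) i j :
  `|X i j| <= frob X.
Proof.
rewrite -sqrtr_sqr ler_wsqrtr // (bigD1 i) //= (bigD1 j) //= -addrA lerDl.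
apply: addr_ge0; first by apply: sumr_ge0 => k _; exact: sqr_ge0.
by apply: sumr_ge0 => l _; apply: sumr_ge0 => k _; exact: sqr_ge0.
Qed.

Lemma frob_le (R : realType) (n : nat) (X : 'M[R]_n) (c : R) :
  0 <= c -> (forall i j, `|X i j| <= c) -> frob X <= n%:R * c.
Proof.
move=> c0 Xc; rewrite -[leRHS]ger0_norm ?mulr_ge0 // -sqrtr_sqr ler_wsqrtr //.
apply: (@le_trans _ _ (\sum_(i < n) \sum_(j < n) c ^+ 2)).
  do 2![apply: ler_sum => ? _]; rewrite -real_normK ?num_real //.
  by rewrite lerXn2r ?nnegrE.
by rewrite !sumr_const !card_ord -mulrnA exprMn -natrX mulr_natl mulnn.
Qed.

(** With [t = m / (2 * n%:R)], a diagonal entry loses at most [t] and the other entries of its row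
    total at most [(n - 1) t]; the dominance margin left is [m - n t = m / 2]. *)
Lemma det_near_signs (R : realType) (n : nat) (X : 'M[R]_n) (s : 'I_n -> R)
    (m : R) :
  0 < m -> (forall i, `|s i| = 1) ->
  (forall i j, `|X i j - m * (s i * (j == i)%:R)| <= m / (2 * n%:R)) ->
  (m / 2) ^+ n <= `|\det X|.
Proof.
move=> m0 s1 Xs; apply: diag_dominant_det_ge => [|i]; first by rewrite divr_gt0.
set t := m / (2 * n%:R) in Xs.
have n0 : n%:R != 0 :> R.
  by rewrite pnatr_eq0 -lt0n (leq_ltn_trans _ (ltn_ord i)).
have nt : n%:R * t = m / 2 by rewrite /t; field.
have diag : m - t <= `|X i i|.
  have := Xs i i; rewrite eqxx mulr1 distrC => h.
  have := lerB_dist (m * s i) (m * s i - X i i).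
  by rewrite normrM s1 mulr1 gtr0_norm // subKr; lra.
have off : \sum_(j < n | j != i) `|X i j| <= \sum_(j < n | j != i) t.
  by apply: ler_sum => j ji; have := Xs i j; rewrite (negbTE ji) !mulr0 subr0.
have tE : \sum_(j < n) t = m / 2 by rewrite sumr_const card_ord -nt mulr_natl.
rewrite (bigD1 i) //= in tE; lra.
Qed.

(** Take [Z] to be the maximum of 1 and [F]: then [1 + F <= 2 * Z], and the power of [Z] is one of
    the two summands on the right. *)
Lemma powR_affine_le (R : realType) (p K F Y : R) :
  0 <= p -> 0 <= K -> 0 <= F -> 0 <= Y -> Y <= K * (1 + F) ->
  Y `^ p <= (2 * K) `^ p * (1 + F `^ p).
Proof.
move=> p0 K0 F0 Y0 YK.
have K20 : 0 <= 2 * K by rewrite mulr_ge0.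
have Fp0 := powR_ge0 F p.
suff [Z [Z0 YZ Zp]] : exists Z,
    [/\ 0 <= Z, Y <= 2 * K * Z & Z `^ p <= 1 + F `^ p].
  apply: (@le_trans _ _ ((2 * K * Z) `^ p)).
    by rewrite ge0_ler_powR // ?nnegrE // mulr_ge0.
  by rewrite powRM // ler_wpM2l // powR_ge0.
have [F1|F1] := leP F 1.
  exists 1; split=> //; last by rewrite powR1; lra.
  by rewrite (le_trans YK) // mulr1 [2 * K]mulrC ler_wpM2l //; lra.
exists F; split=> //; last by lra.
by rewrite (le_trans YK) // [2 * K]mulrC -mulrA ler_wpM2l //; lra.
Qed.

(** * The vector field and its gradient *)

Section BumpField.
Context {R : realType} {N : nat}.
Implicit Types y z : 'rV[R]_N.

Definition bump_field (m : R) (eps : rat) y : 'rV[R]_N :=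
  m *: \row_k bump eps k y.

Lemma bump_field_W1inf0 m eps : 0 <= eps <= 1 -> W1inf0 (bump_field m eps).
Proof.
move=> e01; have /andP[e0 _] := e01; split.
  exists (`|m| * 2) => y z yc zc; rewrite -scalerBr normrZ -mulrA ler_wpM2l //.
  apply: ler_mx_norm => [|i k]; first by rewrite mulr_ge0.
  by rewrite !mxE; exact: bump_lipschitz.
by move=> y ybd; apply/rowP => k; rewrite !mxE bump_bd ?mulr0.
Qed.

Lemma grad_bump_field m eps y : 0 <= m -> 0 < eps ->
  (forall i, 0 < y 0 i < 1) -> rat_generic y ->
  exists2 s : 'I_N -> R, (forall i, `|s i| = 1) &
    forall i j, `|grad (bump_field m eps) y i j - m * (s i * (j == i)%:R)|
                <= m * ratr eps.
Proof.
move=> m0 e0 yo gen_y.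
have /choice [q /choice [b qbP]] := fun k => affine_near_bump k e0 yo gen_y.
have /choice [s sP] : forall k, exists s : rat, `|s| = 1 /\
    forall j, `|q k 0 j - s * (j == k)%:R| <= eps.
  by move=> k; have [[s s1 sq] _] := qbP k; exists s.
(* Column [k] of the row-convention Jacobian is the gradient of component [k]; the finitely many
   neighbourhoods are intersected. *)
have Jac : 'J (bump_field m eps) y = \matrix_(j, k) (m * ratr (q k 0 j)).
  apply: (@jacobian_near_affine _ _ _ _ (\row_k (m * ratr (b k)))).
  have : \forall z \near y, forall k, bump eps k z = rat_affine (q k) (b k) z.
    exact: (filter_forall (nbhs_filter y) (fun k => (qbP k).2)).
  apply: filterS => z bE; apply/rowP => k; rewrite !mxE bE mulrDr mulr_sumr.
  by congr (_ + _); apply: eq_bigr => j _; rewrite mxE; ring.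
exists (fun k => ratr (s k)) => [i|i j].
  by have [s1 _] := sP i; rewrite -ratr_norm s1 rmorph1.
rewrite /grad Jac !mxE -mulrBr normrM ger0_norm // ler_wpM2l //.
have [_ /(_ j)] := sP i.
by rewrite -(ler_rat R) ratr_norm rmorphB rmorphM /= rmorph_nat.
Qed.

End BumpField.

(** * Integration over generic points and the growth bound *)

(** Non-generic points lie on hyperplanes with rational coefficients, a countable family. *)
Lemma cube_integral_le_generic (R : realType) (n : nat) (g : 'rV[R]_n -> \bar R)
    (c : R) :
  0 <= c -> (forall y, (0 <= g y)%E) ->
  (forall y : 'rV[R]_n, (forall i, 0 < y 0 i < 1) -> rat_generic y ->
     (g y <= c%:E)%E) ->
  (cube_integral g <= c%:E)%E.
Proof.
move=> c0 g0 gc.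
apply: (@cube_integral_le_off_hyperplanes _ _ ('rV[rat]_n * rat)%type
  (fun i => map_mx ratr i.1) (fun i => ratr i.2)) => // y yo yH.
apply: gc => // q b qb0; apply/eqP; apply: contraT => q0.
suff /yH /eqP[] : map_mx ratr (q, b).1 != 0 :> 'rV[R]_n.
  by rewrite -[RHS]qb0; congr (_ + _); apply: eq_bigr => j _; rewrite mxE.
apply: contra q0 => /eqP h; apply/eqP/rowP => j.
by move/rowP/(_ j): h; rewrite !mxE => /eqP; rewrite fmorph_eq0 => /eqP.
Qed.

Theorem theorem4p1 (R : realType) (N : nat) (p : R)
    (f : 'rV[R]_N * 'M[R]_N -> \bar R) :
  (0 < N)%N -> 1 <= p ->
  (forall z, (0 <= f z)%E) -> normal_integrand f ->
  (exists alpha beta : R, 0 < alpha /\ 0 < beta /\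
     forall (x : 'rV[R]_N) (xi : 'M[R]_N),
       alpha <= `|\det xi| -> (f (x, xi) <= (beta * (1 + frob xi `^ p))%:E)%E) ->
  exists c : R, 0 < c /\
    forall (x : 'rV[R]_N) (xi : 'M[R]_N),
      (Zf f x xi <= (c * (1 + frob xi `^ p))%:E)%E.
Proof.
move=> N0 p1 f0 _ [alpha [beta [a0 [b0 fb]]]].
have N1 : 1 <= N%:R :> R by rewrite ler1n.
have N0R : 0 < N%:R :> R by lra.
(* The term [4 * N%:R] makes the entries of [xi] at most [m / (4 * N%:R)], and [2 * alpha] makes
   [m / 2] exceed [alpha]. [K] comes from bounding the entries of [X] by [2 * m]. *)
pose mu : R := 4 * N%:R + 2 * alpha; pose K : R := 2 * N%:R * mu.
have mu0 : 0 < mu by rewrite /mu; lra.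
have K0 : 0 <= K by rewrite mulr_ge0 ?ltW // mulr_gt0.
have Kp0 := powR_ge0 (2 * K) p.
exists (beta * (1 + (2 * K) `^ p)); split; first by rewrite mulr_gt0 //; lra.
move=> x xi; set F := frob xi.
have F0 : 0 <= F by exact: sqrtr_ge0.
have Fp0 := powR_ge0 F p.
pose m := mu * (1 + F); pose eps : rat := (4 * N%:R)^-1.
have m0 : 0 < m by rewrite mulr_gt0 //; lra.
have e01 : 0 < eps <= 1.
  rewrite invr_gt0 mulr_gt0 ?ltr0n //=.
  by rewrite invf_le1 -?natrM ?ler1n ?ltr0n ?muln_gt0.
have /andP[e0 e1] := e01.
have epsE : ratr eps = (4 * N%:R)^-1 :> R.
  by rewrite /eps fmorphV rmorphM /= !rmorph_nat.
apply: ereal_inf_le.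
exists (cube_integral (fun y => f (x, xi + grad (bump_field m eps) y))).
  by exists (bump_field m eps) => //; apply: bump_field_W1inf0; rewrite ltW.
apply: cube_integral_le_generic => [|//|y yo gen_y].
  by apply: mulr_ge0; [apply: mulr_ge0|]; lra.
have [s s1 grads] := grad_bump_field (ltW m0) e0 yo gen_y.
set X := xi + _.
(* The tolerance of [det_near_signs] is shared equally between [xi] and the gradient error
   [m * ratr eps]. *)
have near_s i j : `|X i j - m * (s i * (j == i)%:R)| <= m / (2 * N%:R).
  have xim : `|xi i j| <= m / (4 * N%:R).
    apply: le_trans (coord_le_frob _ _ _) _; rewrite -/F.
    rewrite ler_pdivlMr; last by lra.
    have : 4 * N%:R * (1 + F) <= m by rewrite ler_wpM2r // /mu; lra.
    nra.
  have gij := grads i j; rewrite epsE in gij; rewrite [X i j]mxE -addrA.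
  apply: le_trans (ler_normD _ _) _; apply: le_trans (lerD xim gij) _.
  by rewrite le_eqVlt; apply/orP; left; apply/eqP; field; rewrite gt_eqF.
have m_half : m / (2 * N%:R) <= m / 2.
  by rewrite ler_pM2l // lef_pV2 ?posrE; lra.
have m2 : 2 * N%:R + alpha <= m / 2.
  by rewrite /m /mu; nra.
have detX : alpha <= `|\det X|.
  apply: le_trans (det_near_signs m0 s1 near_s).
  (* Since [1 <= m / 2] and [N] is positive, the power [(m / 2) ^+ N] is at least [m / 2]. *)
  apply: (@le_trans _ _ (m / 2)); first by lra.
  by rewrite -{1}[m / 2]expr1 ler_eXn2l //; lra.
apply: le_trans (fb x X detX) _; rewrite lee_fin -mulrA.
apply: ler_wpM2l; first exact: ltW.
have : frob X <= K * (1 + F).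
  apply: le_trans (frob_le (c := 2 * m) _ _) _; first by lra.
    move=> i j; have := near_s i j; rewrite distrC => h.
    have := lerB_dist (X i j) (m * (s i * (j == i)%:R)).
    rewrite distrC; have : `|m * (s i * (j == i)%:R)| <= m.
      rewrite normrM [X in _ * X]normrM s1 (gtr0_norm m0) mul1r normr_nat.
      by rewrite ler_piMr ?lern1 ?leq_b1 // ltW.
    lra.
  by rewrite /K /m; lra.
move=> /(powR_affine_le (le_trans ler01 p1) K0 F0 (sqrtr_ge0 _)).
move: (frob X `^ p) ((2 * K) `^ p) (F `^ p) Kp0 Fp0 => u v w v0 w0 uvw.
by rewrite mulrDl mul1r; lra.
Qed.
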